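(* Let $\mathbf{a}=(a_1,a_2,\ldots)$ and $\mathbf{e}=(e_1,e_2,\ldots)$ be real sequences, either both infinite or both finite of the same length, and suppose $\mathbf{a}$ is non-decreasing. Then: (1) the matrix $S^{\mathbf{a},\mathbf{e}}$ is totally non-negative if and only if $\mathbf{e}$ is a restricted growth sequence relative to $\mathbf{a}$; and (2) if $\mathbf{e}$ is not a restricted growth sequence relative to $\mathbf{a}$, then $S^{\mathbf{a},\mathbf{e}}$ has a negative entry.
   Context: For real sequences $\mathbf{a},\mathbf{e}$ (both infinite, or both of length $n$), the matrix $S^{\mathbf{a},\mathbf{e}}=[S^{\mathbf{a},\mathbf{e}}(m,k)]_{m,k\ge 0}$ (indexed by $\{0,1,2,\ldots\}$ in the infinite case and by $\{0,1,\ldots,n\}$ in the finite case) is defined by the unique expansions $\prod_{i=1}^m(x-e_i)=\sum_{k=0}^m S^{\mathbf{a},\mathbf{e}}(m,k)\prod_{i=1}^k(x-a_i)$ for each $m\ge 0$ (and $S^{\mathbf{a},\mathbf{e}}(m,k)=0$ for $k>m$). A matrix (finite or infinite) is totally non-negative if all its minors (determinants of finite square submatrices) are non-negative. For non-decreasing $\mathbf{a}$, $\mathbf{e}$ is a restricted growth sequence relative to $\mathbf{a}$ if $e_i\le a_{f(i)}$ for every $i\ge 1$, where $f(1)=1$ and, for $i\ge1$, $f(i+1)=f(i)$ if $e_i<a_{f(i)}$ and $f(i+1)=f(i)+1$ if $e_i=a_{f(i)}$. *)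

(* Defs.v *)
From HB Require Import structures.
From mathcomp Require Import all_boot all_order all_algebra.
From mathcomp Require Import boolp reals.

Set Implicit Arguments.
Unset Strict Implicit.
Unset Printing Implicit Defensive.

Import Order.TTheory GRing.Theory Num.Theory.
Local Open Scope ring_scope.

(* Sequences are indexed from 0: [u i] and [nth 0 u i] stand for u_{i+1}. *)

Definition newton_poly (R : realType) (u : nat -> R) (m : nat) : {poly R} :=
  \prod_(i < m) ('X - (u i)%:P).

Definition is_conn_matrix (R : realType) (a e : nat -> R)
    (S : nat -> nat -> R) : Prop :=
  (forall m, newton_poly e m = \sum_(k < m.+1) S m k *: newton_poly a k) /\
  (forall m k, (m < k)%N -> S m k = 0).

Lemma newton_poly_monic (R : realType) (u : nat -> R) m :
  newton_poly u m \is monic.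
Proof. exact: monic_prod_XsubC. Qed.

Lemma size_newton_poly (R : realType) (u : nat -> R) m :
  size (newton_poly u m) = m.+1.
Proof. by rewrite /newton_poly size_prod_XsubC /index_enum -enumT size_enum_ord. Qed.

Lemma newton_expansion (R : realType) (a : nat -> R) m (p : {poly R}) :
  (size p <= m)%N -> exists c : nat -> R, p = \sum_(k < m) c k *: newton_poly a k.
Proof.
elim: m p => [|m IHm] p.
  rewrite leqn0 size_poly_eq0 => /eqP ->.
  by exists (fun=> 0); rewrite big_ord0.
move=> szp.
have szq : (size (p - p`_m *: newton_poly a m)%R <= m)%N.
  apply/leq_sizeP => j; rewrite leq_eqVlt => /orP[/eqP <-|ltmj].
    have := newton_poly_monic a m; rewrite monicE lead_coefE size_newton_poly /=.
    by move=> /eqP lc; rewrite coefB coefZ lc mulr1 subrr.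
  rewrite coefB coefZ [(newton_poly a m)`_j]nth_default ?size_newton_poly // mulr0 subr0.
  rewrite nth_default //.
  exact: leq_trans szp ltmj.
have [c Ec] := IHm _ szq.
exists (fun k => if k == m then p`_m else c k).
rewrite big_ord_recr /= eqxx.
rewrite (eq_bigr (fun k : 'I_m => c k *: newton_poly a k)) => [|k _]; last first.
  by rewrite (ltn_eqF (ltn_ord k)).
by rewrite -Ec subrK.
Qed.

Lemma newton_free (R : realType) (a : nat -> R) m (c : nat -> R) :
  \sum_(k < m) c k *: newton_poly a k = 0 -> forall k, (k < m)%N -> c k = 0.
Proof.
elim: m => [//|m IHm]; rewrite big_ord_recr /= => E0.
have cm0 : c m = 0.
  have /(congr1 (fun p : {poly R} => p`_m)) := E0.
  rewrite coefD coefZ coef0 [X in X + _]nth_default; last first.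
    apply: (leq_trans (size_sum _ _ _)); apply/bigmax_leqP => k _.
    by apply: (leq_trans (size_scale_leq _ _)); rewrite size_newton_poly ltn_ord.
  have := newton_poly_monic a m; rewrite monicE lead_coefE size_newton_poly /=.
  by move=> /eqP ->; rewrite add0r mulr1.
move: E0; rewrite cm0 scale0r addr0 => /IHm ck k.
by rewrite ltnS leq_eqVlt => /orP[/eqP -> //|/ck].
Qed.

Lemma conn_matrix_ex (R : realType) (a e : nat -> R) :
  exists S, is_conn_matrix a e S.
Proof.
have H m : exists c : nat -> R,
    newton_poly e m = \sum_(k < m.+1) c k *: newton_poly a k.
  by apply: newton_expansion; rewrite size_newton_poly.
pose c m := sval (cid (H m)).
exists (fun m k => if (k <= m)%N then c m k else 0); split=> [m|m k].
  rewrite {1}(svalP (cid (H m))); apply: eq_bigr => k _.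
  by rewrite -ltnS ltn_ord.
by rewrite ltnNge => /negbTE ->.
Qed.

Lemma is_conn_matrix_uniq (R : realType) (a e : nat -> R) S T :
  is_conn_matrix a e S -> is_conn_matrix a e T -> S = T.
Proof.
move=> [S1 S2] [T1 T2]; apply/funext => m; apply/funext => k.
have [ltmk|lekm] := ltnP m k; first by rewrite S2 // T2.
apply/eqP; rewrite -subr_eq0; apply/eqP.
apply: (@newton_free R a m.+1 (fun k => S m k - T m k)) => //.
under eq_bigr do rewrite scalerBl.
by rewrite sumrB -S1 -T1 subrr.
Qed.

Definition conn_matrix (R : realType) (a e : nat -> R) : nat -> nat -> R :=
  sval (cid (conn_matrix_ex a e)).

Lemma conn_matrixP (R : realType) (a e : nat -> R) :
  is_conn_matrix a e (conn_matrix a e).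
Proof. exact: svalP (cid (conn_matrix_ex a e)). Qed.

(* For m <= n, row m of [conn_matrix a e] only involves the first m terms of
   a and e, so the default value of [nth] is irrelevant; [fin_conn_matrixP]
   characterizes this matrix through the terms of the tuples only. *)
Definition fin_conn_matrix (R : realType) (n : nat) (a e : n.-tuple R) :
    'M[R]_n.+1 :=
  \matrix_(m < n.+1, k < n.+1) conn_matrix (nth 0 a) (nth 0 e) m k.

Lemma newton_poly_take (R : realType) n (u : n.-tuple R) m : (m <= n)%N ->
  newton_poly (nth 0 u) m = \prod_(x <- take m u) ('X - x%:P).
Proof.
move=> lemn; rewrite /newton_poly (big_nth 0) size_takel ?size_tuple //.
by rewrite big_mkord; apply: eq_bigr => i _; rewrite nth_take.
Qed.

Lemma fin_conn_matrixP (R : realType) n (a e : n.-tuple R) (M : 'M[R]_n.+1) :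
  M = fin_conn_matrix a e <->
  (forall m : 'I_n.+1, \prod_(x <- take m e) ('X - x%:P) =
     \sum_(k < n.+1 | (k <= m)%N) M m k *: \prod_(x <- take k a) ('X - x%:P)) /\
  (forall m k : 'I_n.+1, (m < k)%N -> M m k = 0).
Proof.
have [E Z] := conn_matrixP (nth 0 a) (nth 0 e).
have narrow (m : 'I_n.+1) (F : nat -> {poly R}) :
    \sum_(k < m.+1) F k = \sum_(k < n.+1 | (k <= m)%N) F k.
  by rewrite (big_ord_widen _ F (ltn_ord m)).
have E' (m : 'I_n.+1) : \prod_(x <- take m e) ('X - x%:P) =
    \sum_(k < n.+1 | (k <= m)%N) conn_matrix (nth 0 a) (nth 0 e) m k
       *: newton_poly (nth 0 a) k.
  rewrite -newton_poly_take -1?ltnS // E.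
  exact: (narrow m (fun k => conn_matrix (nth 0 a) (nth 0 e) m k
       *: newton_poly (nth 0 a) k)).
split=> [->|[M1 M2]].
  split=> [m|m k ltmk]; last by rewrite mxE Z.
  rewrite E'; apply: eq_bigr => k _.
  by rewrite mxE newton_poly_take // -ltnS.
apply/matrixP => m k; rewrite mxE.
have [ltmk|lekm] := ltnP m k; first by rewrite M2 // Z.
apply/eqP; rewrite -subr_eq0; apply/eqP.
pose d j := M m (inord j) - conn_matrix (nth 0 a) (nth 0 e) m j.
suff : d k = 0 by rewrite /d inord_val.
apply: (@newton_free R (nth 0 a) m.+1 d) => //.
rewrite (narrow m (fun k => d k *: newton_poly (nth 0 a) k)).
under eq_bigr do rewrite /d inord_val scalerBl.
rewrite sumrB -E' M1; apply/eqP; rewrite subr_eq0; apply/eqP.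
by apply: eq_bigr => j _; rewrite newton_poly_take // -ltnS.
Qed.

(* Covers infinite matrices (I = nat) and finite ones (I = 'I_n). *)
Definition totally_nonneg (R : realType) (d : Order.disp_t) (I : porderType d)
    (M : I -> I -> R) : Prop :=
  forall (r : nat) (f g : 'I_r -> I),
    {homo f : p q / (p < q)%N >-> (p < q)%O} ->
    {homo g : p q / (p < q)%N >-> (p < q)%O} ->
    0 <= \det (\matrix_(p < r, q < r) M (f p) (g q)).

(* With indices shifted by one, this is the function f of restricted growth.
   Its value after an index i with e_i > a_{f(i)} is immaterial, since such an
   e is not a restricted growth sequence. *)
Fixpoint rg_index (R : realType) (a e : nat -> R) (i : nat) : nat :=
  if i is j.+1 then
    if e j < a (rg_index a e j) then rg_index a e j else (rg_index a e j).+1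
  else 0%N.

Definition restricted_growth (R : realType) (a e : nat -> R) : Prop :=
  forall i, e i <= a (rg_index a e i).

(* [rg_index _ _ i <= i], so only genuine terms of a and e are involved. *)
Definition fin_restricted_growth (R : realType) (n : nat) (a e : n.-tuple R) :
    Prop :=
  forall i, (i < n)%N -> nth 0 e i <= nth 0 a (rg_index (nth 0 a) (nth 0 e) i).

(* Main.v *)
(* Let e' and a+ be e and a without their first terms. If e_1 = a_1, then S^{a,e}
   is the block sum of 1 and S^{a+,e'}; if e_1 < a_1, then S^{a,e} is the block
   sum of 1 and S^{a,e'}, multiplied on the right by a lower bidiagonal matrix
   with entries 1 and a_k - e_1 >= 0. Restricted growth passes to the smaller
   pair, and both operations preserve total non-negativity. Conversely, at the
   first i with e_i > a_{f(i)}, row i - 1 of S^{a,e} has its first nonzero entry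
   in column f(i) - 1, where it is positive, so the entry just below it is that
   entry times a_{f(i)} - e_i < 0. *)

Require Import Defs.
From HB Require Import structures.
From mathcomp Require Import all_boot all_order all_algebra.
From mathcomp Require Import boolp reals.
From mathcomp Require Import ring.

Set Implicit Arguments.
Unset Strict Implicit.
Unset Printing Implicit Defensive.

Import Order.TTheory GRing.Theory Num.Theory.
Local Open Scope ring_scope.

(** * Recurrences for the connection coefficients *)

Fixpoint conn_rec (R : realType) (a e : nat -> R) (m k : nat) : R :=
  if m is m'.+1 then
    (if k is k'.+1 then conn_rec a e m' k' else 0)
      + (a k - e m') * conn_rec a e m' k
  else (k == 0)%:R.

Lemma conn_rec_eq0 (R : realType) (a e : nat -> R) m k :
  (m < k)%N -> conn_rec a e m k = 0.
Proof.
elim: m k => [|m IHm] [|k] //= ltmk.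
by rewrite !IHm ?mulr0 ?addr0 // ltnW.
Qed.

Lemma conn_matrix_rec (R : realType) (a e : nat -> R) :
  conn_matrix a e = conn_rec a e.
Proof.
apply: (is_conn_matrix_uniq (conn_matrixP a e)); split; last exact: conn_rec_eq0.
elim=> [|m IHm].
  by rewrite big_ord_recl big_ord0 addr0 /= scale1r /newton_poly !big_ord0.
have newtonS u k : newton_poly u k.+1 = newton_poly u k * ('X - (u k)%:P) :> {poly R}.
  by rewrite /newton_poly big_ord_recr.
(* Writing x - [e m] as (x - [a k]) + ([a k - e m]) sends each basis term to columns k + 1 and k,
   which is the recurrence of [conn_rec]. *)
have step k : newton_poly a k * ('X - (e m)%:P) =
    newton_poly a k.+1 + (a k - e m) *: newton_poly a k.
  by rewrite newtonS -mul_polyC polyCB; ring.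
rewrite newtonS IHm mulr_suml.
under eq_bigr do rewrite -scalerAl step scalerDr scalerA.
rewrite big_split /=.
under [RHS]eq_bigr do rewrite scalerDl.
rewrite big_split /=; congr (_ + _).
  by rewrite [RHS]big_ord_recl /= scale0r add0r.
(* The term k = m + 1 drops out, as row m ends on the diagonal. *)
rewrite [RHS]big_ord_recr /= conn_rec_eq0 // mulr0 scale0r addr0.
by apply: eq_bigr => k _; rewrite mulrC.
Qed.

(* Peeling off the first factor [x - e_0] of the Newton polynomials of e,
   rather than the last one as in [conn_rec]. *)
Lemma conn_rec_shift (R : realType) (a e : nat -> R) m k :
  conn_rec a e m.+1 k =
    (if k is k'.+1 then conn_rec a (e \o succn) m k' else 0)
      + (a k - e 0) * conn_rec a (e \o succn) m k.
Proof.
elim: m k => [|m IHm] k; first by [].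
rewrite -[LHS]/((if k is k'.+1 then conn_rec a e m.+1 k' else 0)
      + (a k - e m.+1) * conn_rec a e m.+1 k).
case: k => [|k]; first by rewrite IHm /=; ring.
by rewrite !IHm; case: k => [|k] /=; ring.
Qed.

(** When [e 0 = a 0], all Newton polynomials of positive degree for [a] and [e] share the factor x -
    [a 0]; dividing it out leaves the expansion for the shifted sequences. *)
Lemma conn_rec_shift_eq (R : realType) (a e : nat -> R) m k : e 0 = a 0 ->
  conn_rec a e m.+1 k =
    if k is k'.+1 then conn_rec (a \o succn) (e \o succn) m k' else 0.
Proof.
move=> e0; elim: m k => [|m IHm] k.
  by case: k => [|k] /=; rewrite ?e0 ?subrr ?mul0r ?addr0 ?mulr0 ?addr0.
rewrite -[LHS]/((if k is k'.+1 then conn_rec a e m.+1 k' else 0)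
      + (a k - e m.+1) * conn_rec a e m.+1 k).
by case: k => [|k]; rewrite !IHm ?mulr0 ?addr0 //; case: k => [|k].
Qed.

(** * Operations preserving total non-negativity *)

(** Minors are confined to the leading N x N block, so that an induction on N serves finite and
    infinite sequences alike. *)
Definition tn_below (R : realType) (N : nat) (M : nat -> nat -> R) : Prop :=
  forall (r : nat) (f g : 'I_r -> nat),
    {homo f : p q / (p < q)%N} -> {homo g : p q / (p < q)%N} ->
    (forall p, f p < N)%N -> (forall p, g p < N)%N ->
    0 <= \det (\matrix_(p < r, q < r) M (f p) (g q)).

Lemma eq_tn_below (R : realType) N (M M' : nat -> nat -> R) :
  (forall m k, (m < N)%N -> (k < N)%N -> M m k = M' m k) ->
  tn_below N M -> tn_below N M'.
Proof.
move=> eqM tnM r f g incf incg ltf ltg.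
suff -> : \matrix_(p, q) M' (f p) (g q) = \matrix_(p, q) M (f p) (g q).
  exact: tnM.
by apply/matrixP => p q; rewrite !mxE eqM.
Qed.

(** A minor that uses column t is linear in that column: it splits into the old minor and c times
    the one with column t + 1 in its place, which is zero or again a minor of M. *)
Lemma tn_below_col_op (R : realType) N (M : nat -> nat -> R) t c :
  tn_below N M -> (t.+1 < N)%N -> 0 <= c ->
  tn_below N (fun m k => M m k + (k == t)%:R * (c * M m k.+1)).
Proof.
move=> tnM ltN c_ge0 r f g incf incg ltf ltg.
have [/existsP[q0 /eqP gq0]|/existsPn gt] := boolP [exists q, g q == t]; last first.
  suff -> : \matrix_(p, q) (M (f p) (g q) + (g q == t)%:R * (c * M (f p) (g q).+1)) =
     \matrix_(p, q) M (f p) (g q) by exact: tnM.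
  by apply/matrixP => p q; rewrite !mxE (negbTE (gt q)) mul0r addr0.
pose g' q := if q == q0 then t.+1 else g q.
have g_inj p : p != q0 -> g p != t.
  rewrite -val_eqE neq_ltn => /orP[/incg|/incg]; rewrite gq0.
    by move=> /ltn_eqF ->.
  by move=> /gtn_eqF ->.
set A' := (\matrix_(p, q) _).
pose A := \matrix_(p < r, q < r) M (f p) (g q).
pose B := \matrix_(p < r, q < r) M (f p) (g' q).
have -> : \det A' = \det A + c * \det B.
  rewrite -(det_tr A') -(det_tr A) -(det_tr B) -[X in X + _]mul1r.
  apply: (determinant_multilinear (i0 := q0)).
  - by apply/rowP => p; rewrite !mxE gq0 /g' !eqxx !mul1r.
  - apply/matrixP => q p; rewrite !mxE.
    by rewrite (negbTE (g_inj _ _)) ?mul0r ?addr0 // eq_sym neq_lift.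
  - apply/matrixP => q p; rewrite !mxE.
    rewrite (negbTE (g_inj _ _)) ?mul0r ?addr0 1?eq_sym ?neq_lift //.
    by rewrite /g' eq_sym (negbTE (neq_lift _ _)).
apply: addr_ge0; first exact: tnM.
apply: mulr_ge0 => //.
have [/existsP[q1 /eqP gq1]|/existsPn gt1] := boolP [exists q, g q == t.+1].
  have q10 : q0 != q1.
    by apply/eqP => q01; move: gq1; rewrite -q01 gq0 => /eqP; rewrite ltn_eqF.
  rewrite -det_tr (determinant_alternate q10) // => p.
  by rewrite !mxE /g' eqxx eq_sym (negbTE q10) gq1.
apply: tnM => // [p q ltpq|p]; rewrite /g'; last by case: ifP.
(* No integer lies strictly between t and t + 1, and t + 1 is not a chosen column, so [g'] stays
   increasing. *)
have := incg _ _ ltpq.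
case: eqP => [->|_]; case: eqP => [->|_] //; rewrite gq0.
- by rewrite ltnn.
- by move=> lttq; rewrite ltn_neqAle eq_sym gt1.
- by move=> /ltnW; rewrite ltnS.
Qed.

(* Right multiplication by a lower bidiagonal matrix; adding column [k + 1] to
   column [k] for increasing [k] only ever uses columns not yet modified. *)
Lemma tn_below_bidiagonal (R : realType) N (M : nat -> nat -> R) (b : nat -> R) :
  tn_below N M -> (forall k, (k.+1 < N)%N -> 0 <= b k) ->
  (forall m, (m < N)%N -> M m N = 0) ->
  tn_below N (fun m k => M m k + b k * M m k.+1).
Proof.
move=> tnM b_ge0 M0.
have sweep t : (t <= N.-1)%N ->
    tn_below N (fun m k => M m k + (k < t)%:R * (b k * M m k.+1)).
  elim: t => [|t IHt] ltt.
    by apply: eq_tn_below tnM => m k _ _; rewrite mul0r addr0.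
  have ltN : (t.+1 < N)%N by case: (N) ltt.
  apply: eq_tn_below (tn_below_col_op (IHt (ltnW ltt)) ltN (b_ge0 _ ltN)).
  move=> m k _ _; rewrite [(k < t.+1)%N]ltnS [(k <= t)%N]leq_eqVlt.
  case: eqP => [->|_] /=; last by rewrite !mul0r addr0.
  by rewrite ltnn [(t.+1 < t)%N]ltnNge leqnSn !mul0r !addr0.
apply: eq_tn_below (sweep _ (leqnn _)) => m k ltm ltk.
(* Column N - 1 was not swept; its right neighbour, column N, vanishes by [M0]. *)
have [_|lek] := ltnP k N.-1; first by rewrite mul1r.
have -> : k.+1 = N.
  apply/eqP; rewrite eqn_leq ltk.
  by case: (N) lek.
by rewrite M0 // !mulr0.
Qed.

Definition border (R : realType) (M : nat -> nat -> R) (m k : nat) : R :=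
  match m, k with
  | 0, 0 => 1
  | m'.+1, k'.+1 => M m' k'
  | _, _ => 0
  end.

(** Indices increase, so only the first row or column of a minor can be the bordering one. If both
    are, expansion along that row leaves a minor of M; if exactly one is, it is a zero line. *)
Lemma tn_below_border (R : realType) N (M : nat -> nat -> R) :
  tn_below N M -> tn_below N.+1 (border M).
Proof.
move=> tnM.
have pos r (f g : 'I_r -> nat) :
    {homo f : p q / (p < q)%N} -> {homo g : p q / (p < q)%N} ->
    (forall p, f p < N.+1)%N -> (forall p, g p < N.+1)%N ->
    (forall p, 0 < f p)%N -> (forall p, 0 < g p)%N ->
    0 <= \det (\matrix_(p < r, q < r) border M (f p) (g q)).
  move=> incf incg ltf ltg f0 g0.
  have -> : \matrix_(p, q) border M (f p) (g q) =
      \matrix_(p, q) M (f p).-1 (g q).-1.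
    apply/matrixP => p q; rewrite !mxE.
    by case: (f p) (g q) (f0 p) (g0 q) => [|?] [|?].
  have pred_inc (h : 'I_r -> nat) : {homo h : p q / (p < q)%N} ->
      (forall p, 0 < h p)%N -> {homo (fun p => (h p).-1) : p q / (p < q)%N}.
    by move=> inch h0 p q /inch ltpq; rewrite -ltnS !prednK.
  by apply: tnM; [exact: pred_inc|exact: pred_inc|move=> p|move=> p];
    rewrite -ltnS prednK.
move=> [|r] f g incf incg ltf ltg; first by rewrite det_mx00.
have lift_gt0 (h : 'I_r.+1 -> nat) : {homo h : p q / (p < q)%N} ->
    forall p, (0 < h (lift ord0 p))%N.
  by move=> inch p; apply: leq_ltn_trans (leq0n (h ord0)) (inch _ _ _).
have all_gt0 (h : 'I_r.+1 -> nat) : {homo h : p q / (p < q)%N} ->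
    (0 < h ord0)%N -> forall p, (0 < h p)%N.
  move=> inch h0 p; case: (unliftP ord0 p) => [j ->|-> //].
  exact: lift_gt0.
have lift_inc (h : 'I_r.+1 -> nat) : {homo h : p q / (p < q)%N} ->
    {homo (fun p => h (lift ord0 p)) : p q / (p < q)%N}.
  by move=> inch p q ltpq; apply: inch.
have [f0|f0] := posnP (f ord0); have [g0|g0] := posnP (g ord0).
- rewrite (expand_det_row _ ord0) big_ord_recl big1 => [|j _]; last first.
    by rewrite mxE f0; case: (g _) (lift_gt0 g incg j) => // ? _; rewrite mul0r.
  rewrite addr0 mxE f0 g0 mul1r /cofactor /= expr0 mul1r.
  have -> : row' ord0 (col' ord0 (\matrix_(p, q) border M (f p) (g q))) =
      \matrix_(p, q) border M (f (lift ord0 p)) (g (lift ord0 q)).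
    by apply/matrixP => p q; rewrite !mxE.
  apply: pos => //; [exact: lift_inc|exact: lift_inc|exact: lift_gt0|].
  exact: lift_gt0.
- rewrite (expand_det_row _ ord0) big1 // => j _.
  by rewrite mxE f0; case: (g j) (all_gt0 g incg g0 j) => // ? _; rewrite mul0r.
- rewrite (expand_det_col _ ord0) big1 // => i _.
  by rewrite mxE g0; case: (f i) (all_gt0 f incf f0 i) => // ? _; rewrite mul0r.
- by apply: pos => //; exact: all_gt0.
Qed.

(** * Restricted growth implies total non-negativity *)

Lemma rg_index_shift_lt (R : realType) (a e : nat -> R) i : e 0 < a 0 ->
  rg_index a e i.+1 = rg_index a (e \o succn) i.
Proof.
move=> lt0; elim: i => [|i IHi]; first by rewrite /= lt0.
rewrite -[LHS]/(if e i.+1 < a (rg_index a e i.+1) then rg_index a e i.+1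
  else (rg_index a e i.+1).+1).
by rewrite IHi.
Qed.

Lemma rg_index_shift_eq (R : realType) (a e : nat -> R) i : e 0 = a 0 ->
  rg_index a e i.+1 = (rg_index (a \o succn) (e \o succn) i).+1.
Proof.
move=> eq0; elim: i => [|i IHi]; first by rewrite /= eq0 ltxx.
rewrite -[LHS]/(if e i.+1 < a (rg_index a e i.+1) then rg_index a e i.+1
  else (rg_index a e i.+1).+1).
by rewrite IHi /=; case: ifP.
Qed.

Lemma rg_index_le (R : realType) (a e : nat -> R) i : (rg_index a e i <= i)%N.
Proof. by elim: i => //= i IHi; case: ifP => // _; exact: leqW. Qed.

(** The induction on N quantifies over [a] and [e], since each step changes them. The bounds reflect
    that a block of size N involves only the first N - 1 terms of each sequence. *)
Lemma conn_rec_tn_below (R : realType) N (a e : nat -> R) :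
  (forall i j, (i <= j)%N -> (j.+1 < N)%N -> a i <= a j) ->
  (forall i, (i.+1 < N)%N -> e i <= a (rg_index a e i)) ->
  tn_below N (conn_rec a e).
Proof.
elim: N a e => [|N IHN] a e mono rg.
  move=> [|r] f g _ _ ltf _; first by rewrite det_mx00.
  by have := ltf ord0.
(* A block of size 1 constrains no term of [e]; its only entry is the 1 that borders an empty
   block. *)
have [N0|N_gt0] := posnP N.
  have := tn_below_border (IHN a e _ _); rewrite N0 => tn.
  by apply: eq_tn_below (tn _ _) => // -[|?] [|?].
have := rg 0 N_gt0; rewrite le_eqVlt => /orP[/eqP /= e0|/= lt0].
  have tn : tn_below N (conn_rec (a \o succn) (e \o succn)).
    apply: IHN => [i j leij ltj|i lti] /=; first exact: mono.
    by have := rg i.+1 lti; rewrite rg_index_shift_eq.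
  apply: eq_tn_below (tn_below_border tn) => m k _ _.
  by case: m => [|m]; [case: k|rewrite conn_rec_shift_eq //; case: k].
have tn : tn_below N (conn_rec a (e \o succn)).
  apply: IHN => [i j leij ltj|i lti] /=; first by apply: mono => //; exact: ltnW.
  by have := rg i.+1 lti; rewrite rg_index_shift_lt.
apply: eq_tn_below
  (tn_below_bidiagonal (b := fun k => a k - e 0) (tn_below_border tn) _ _).
- move=> m k _ _; case: m => [|m]; first by case: k => [|k] /=; rewrite mulr0 addr0.
  by rewrite conn_rec_shift; case: k.
- by move=> k ltk; rewrite subr_ge0 (le_trans (ltW lt0)) // mono.
- by case=> [|m] // ltm; exact: conn_rec_eq0.
Qed.

(** * A negative entry when restricted growth fails *)

(* [rg_index a e m] is the number of leading factors of the Newton basis of a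
   that divide [newton_poly e m]. *)
Lemma conn_rec_leading (R : realType) N (a e : nat -> R) m :
  (forall i j, (i <= j)%N -> (j < N)%N -> a i <= a j) ->
  (m <= N)%N -> (forall i, (i < m)%N -> e i <= a (rg_index a e i)) ->
  [/\ forall k, 0 <= conn_rec a e m k,
      forall k, (k < rg_index a e m)%N -> conn_rec a e m k = 0 &
      0 < conn_rec a e m (rg_index a e m)].
Proof.
move=> mono; elim: m => [|m IHm] lemN rg.
  by split=> // [[|k] //=]; rewrite ?ltr01.
have [] := IHm (ltnW lemN) (fun i lti => rg i (ltnW lti)).
have := rg m (ltnSn m); have := rg_index_le a e m.
set j := rg_index a e m => lejm le_ea S_ge0 S_eq0 S_gt0.
(* For k <= m this is [e m <= a j <= a k]; for k > m the entry vanishes, so [a] is never compared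
   beyond its first N terms. *)
have wt_ge0 k : (j <= k)%N -> 0 <= (a k - e m) * conn_rec a e m k.
  move=> lejk; have [ltmk|lekm] := ltnP m k; first by rewrite conn_rec_eq0 // mulr0.
  rewrite mulr_ge0 // subr_ge0 (le_trans le_ea) // mono //.
  exact: leq_ltn_trans lekm lemN.
have S_pred k : (k <= j)%N ->
    (if k is k'.+1 then conn_rec a e m k' else 0) = 0.
  by case: k => // k; exact: S_eq0.
split.
- move=> k /=; rewrite addr_ge0 //; first by case: k.
  by have [/S_eq0 ->|/wt_ge0 //] := ltnP k j; rewrite mulr0.
(* When [e m = a j] the index advances, and the factor [a j - e m] kills the entry in column j. *)
- move=> k /=; rewrite -/j; case: ltP => [_ ltkj|leae].
    by rewrite S_pred ?(ltnW ltkj) // S_eq0 // mulr0 addr0.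
  have -> : e m = a j by apply/le_anti; rewrite le_ea leae.
  rewrite ltnS => lekj; rewrite S_pred // add0r.
  move: lekj; rewrite leq_eqVlt => /orP[/eqP ->|/S_eq0 ->].
    by rewrite subrr mul0r.
  by rewrite mulr0.
(* When the index advances, the positive entry passes diagonally from column j to column j + 1. *)
- rewrite /= -/j; case: (ltP (e m) (a j)) => [ltea|leae].
    by rewrite S_pred // add0r mulr_gt0 // subr_gt0.
  by rewrite ltr_wpDr // wt_ge0.
Qed.

(** The bounds on m and k include N because N terms give a matrix of size N + 1. *)
Lemma conn_rec_neg_entry (R : realType) N (a e : nat -> R) i :
  (forall i j, (i <= j)%N -> (j < N)%N -> a i <= a j) ->
  (i < N)%N -> ~~ (e i <= a (rg_index a e i)) ->
  exists m k, [/\ (m <= N)%N, (k <= N)%N & conn_rec a e m k < 0].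
Proof.
move=> mono ltiN nrg.
pose P i := (i < N)%N && ~~ (e i <= a (rg_index a e i)).
have exP : exists i, P i by exists i; rewrite /P ltiN.
case: (ex_minnP exP) => j /andP[ltjN]; rewrite -ltNge => ltae minj.
have rgj l : (l < j)%N -> e l <= a (rg_index a e l).
  move=> ltlj; apply/negPn/negP => nl.
  have := minj l; rewrite /P nl (ltn_trans ltlj ltjN) => /(_ isT).
  by rewrite leqNgt ltlj.
have [_ S_eq0 S_gt0] := conn_rec_leading mono (ltnW ltjN) rgj.
exists j.+1, (rg_index a e j); split=> //.
  exact: leq_trans (rg_index_le a e j) (ltnW ltjN).
rewrite /= [X in X + _](_ : _ = 0); last first.
  by case: (rg_index a e j) S_eq0 => // k ->.
by rewrite add0r pmulr_llt0 // subr_lt0.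
Qed.

(** * The infinite and the finite case *)

Lemma totally_nonneg_entry (R : realType) d (I : porderType d)
  (M : I -> I -> R) m k : totally_nonneg M -> 0 <= M m k.
Proof.
move=> /(_ 1 (fun=> m) (fun=> k)); rewrite det_mx11 mxE; apply=> p q;
  by rewrite !ord1.
Qed.

Theorem theorem1p2 (R : realType) :
  (forall a e : nat -> R, {homo a : i j / (i <= j)%N >-> i <= j} ->
     (totally_nonneg (conn_matrix a e) <-> restricted_growth a e) /\
     (~ restricted_growth a e -> exists m k : nat, conn_matrix a e m k < 0)) /\
  (forall (n : nat) (a e : n.-tuple R), sorted <=%R a ->
     (totally_nonneg (fin_conn_matrix a e) <-> fin_restricted_growth a e) /\
     (~ fin_restricted_growth a e ->
        exists m k : 'I_n.+1, fin_conn_matrix a e m k < 0)).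
Proof.
split=> [a e mono|n a e sorted_a].
  have neg : ~ restricted_growth a e -> exists m k, conn_matrix a e m k < 0.
    move=> /existsNP[i /negP nrg]; rewrite conn_matrix_rec.
    have [||m [k [_ _ lt0]]] := conn_rec_neg_entry (N := i.+1) _ _ nrg => //.
      by move=> ? ? /mono.
    by exists m, k.
  split=> //; split=> [tn|rg r f g incf incg].
    apply: contrapT => /neg[m [k]].
    by rewrite ltNge totally_nonneg_entry.
  rewrite conn_matrix_rec.
  (* A minor has finitely many indices, and this N exceeds them all. *)
  pose N := (\max_p f p + \max_p g p).+1.
  apply: (@conn_rec_tn_below _ N) => // [? ? /mono //|p|p]; rewrite ltnS.
    by apply: leq_trans (leq_addr _ _); exact: leq_bigmax.
  by apply: leq_trans (leq_addl _ _); exact: leq_bigmax.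
have mono i j : (i <= j)%N -> (j < n)%N -> nth 0 a i <= nth 0 a j.
  move=> leij ltjn; apply: (sorted_leq_nth le_trans lexx) => //;
    rewrite inE size_tuple //.
  exact: leq_ltn_trans leij ltjn.
have neg : ~ fin_restricted_growth a e ->
    exists m k : 'I_n.+1, fin_conn_matrix a e m k < 0.
  move=> /existsNP[i /not_implyP[ltin /negP nrg]].
  have [m [k [lemn lekn lt0]]] := conn_rec_neg_entry mono ltin nrg.
  exists (Ordinal (lemn : (m < n.+1)%N)), (Ordinal (lekn : (k < n.+1)%N)).
  by rewrite mxE conn_matrix_rec.
split=> //; split=> [tn|rg r f g incf incg].
  apply: contrapT => /neg[m [k]].
  by rewrite ltNge totally_nonneg_entry.
have -> : \matrix_(p, q) fin_conn_matrix a e (f p) (g q) =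
    \matrix_(p, q) conn_rec (nth 0 a) (nth 0 e) (f p) (g q).
  by apply/matrixP => p q; rewrite !mxE conn_matrix_rec.
exact: (@conn_rec_tn_below _ n.+1).
Qed.
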